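(* Let $k>0$. The Brownian energy process BEP($k$) on two sites is self-dual with duality function $D(z,w)=J(z_1,w_1)\,J(z_2,w_2)$, where $$J(z,w)=e^{\frac12(z+w)}(zw)^{-k+\frac12}J_{2k-1}(\sqrt{zw}),\qquad z,w\in(0,\infty),$$ and $J_\nu$ is the Bessel function of the first kind. That is, with $L$ the generator of the process on two sites, $$[L D(\cdot,w)](z)=[L D(z,\cdot)](w)\qquad\text{for all } z=(z_1,z_2),\ w=(w_1,w_2)\in(0,\infty)^2 .$$
   Context: The Brownian energy process BEP($k$) on two sites is the diffusion process on $(\mathbb{R}^+)^2$ with generator $$(Lf)(z_1,z_2)=z_1z_2\left(\frac{\partial}{\partial z_1}-\frac{\partial}{\partial z_2}\right)^2f(z_1,z_2)-2k(z_1-z_2)\left(\frac{\partial}{\partial z_1}-\frac{\partial}{\partial z_2}\right)f(z_1,z_2),$$ where $(\partial_{z_1}-\partial_{z_2})^2$ denotes the second-order differential operator obtained by composing $\partial_{z_1}-\partial_{z_2}$ with itself; $L$ acts as this differential operator on smooth functions. A process with generator $L$ and state space $\mathcal{S}$ is called self-dual with self-duality function $D:\mathcal{S}\times\mathcal{S}\to\mathbb{R}$ if $[LD(\cdot,y)](x)=[LD(x,\cdot)](y)$ for all $x,y\in\mathcal{S}$; on the left $L$ acts on $D$ as a function of the first argument, on the right as a function of the second argument. The Bessel function of the first kind is, for $\nu>-1$, $$J_\nu(z)=\frac{(z/2)^\nu}{\Gamma(\nu+1)}\sum_{i=0}^\infty\frac{1}{(\nu+1)_i}\frac{(-z^2/4)^i}{i!},\qquad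 z>0,\qquad (a)_i=\frac{\Gamma(a+i)}{\Gamma(a)} .$$ *)

(* Defs.v *)
From Stdlib Require Import Reals Factorial.
From Coquelicot Require Import Coquelicot.
Open Scope R_scope.

(* Euler's integral; only meaningful for [a > 0], where it converges. *)
Definition Gamma (a : R) : R :=
  RInt_gen (fun t => Rpower t (a - 1) * exp (- t))
    (at_right 0) (Rbar_locally p_infty).

Definition pochhammer (a : R) (i : nat) : R := Gamma (a + INR i) / Gamma a.

(* Used for [nu > -1] and [z > 0] only. *)
Definition BesselJ (nu z : R) : R :=
  Rpower (z / 2) nu / Gamma (nu + 1) *
  Series (fun i => / pochhammer (nu + 1) i * ((- z ^ 2 / 4) ^ i / INR (fact i))).

Definition quadrant (z : R * R) : Prop := 0 < fst z /\ 0 < snd z.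

(* C^infinity on the quadrant.  Since Coquelicot's [Derive] is total, this is
   what ensures that [BEP_generator] is a genuine differential operator. *)
Definition smooth_on_quadrant (f : R * R -> R) : Prop :=
  forall z, quadrant z ->
  forall n, ex_diff_n (fun x y => f (x, y)) n (fst z) (snd z).

Definition partial_diff (f : R * R -> R) (z : R * R) : R :=
  Derive (fun x => f (x, snd z)) (fst z) - Derive (fun y => f (fst z, y)) (snd z).

Definition BEP_generator (k : R) (f : R * R -> R) (z : R * R) : R :=
  fst z * snd z * partial_diff (partial_diff f) z
  - 2 * k * (fst z - snd z) * partial_diff f z.

(* [dom] is the class of functions on which the operator [L] acts; asking that
   both sections of [D] belong to it makes the two sides of the duality relation
   well defined. *)
Definition self_dual {E : Type} (S : E -> Prop) (dom : (E -> R) -> Prop)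
    (L : (E -> R) -> E -> R) (D : E -> E -> R) : Prop :=
  forall x y, S x -> S y ->
    dom (fun x' => D x' y) /\ dom (fun y' => D x y') /\
    L (fun x' => D x' y) x = L (fun y' => D x y') y.

Definition bessel_duality1 (k z w : R) : R :=
  exp (/ 2 * (z + w)) * Rpower (z * w) (- k + / 2) *
  BesselJ (2 * k - 1) (sqrt (z * w)).

Definition bessel_duality (k : R) (z w : R * R) : R :=
  bessel_duality1 k (fst z) (fst w) * bessel_duality1 k (snd z) (snd w).

(* Main.v *)
(** For [z, w > 0] the Bessel series gives
    [J(z, w) = C e^(z/2) e^(w/2) phi(z w)], where [phi(x) = sum_i (-x/4)^i / ((2k)_i i!)]
    is entire and, by [Gamma(a+1) = a Gamma(a)], satisfies
    [x phi'' + 2k phi' + phi/4 = 0].  The derivation [d/dz1 - d/dz2] annihilates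
    [e^((z1+z2)/2)], so with [x = z1 w1], [y = z2 w2] the generator only acts on
    [phi(x) phi(y)].  Eliminating the second derivatives [phi''] through the equation,
    [L D(., w) (z)] becomes [C^2 e^((z1+z2+w1+w2)/2)] times
    [- (z2 w1 + z1 w2) phi(x) phi(y) / 4 - 2 x y phi'(x) phi'(y)
     - 2k (x phi'(x) phi(y) + y phi(x) phi'(y))],
    which is symmetric in [z] and [w], as is [D]. *)
Require Import Defs.
From Stdlib Require Import Reals Factorial Lra PeanoNat.
From Coquelicot Require Import Coquelicot.
Open Scope R_scope.

(** * The integrand of Euler's integral and its limits at 0 and infinity *)

Lemma is_derive_Rpower (a x : R) :
  0 < x -> is_derive (fun t => Rpower t a) x (a * Rpower x (a - 1)).
Proof. intros hx. apply is_derive_Reals. now apply derivable_pt_lim_power. Qed.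

Lemma continuous_Rpower (a x : R) : 0 < x -> continuous (fun t => Rpower t a) x.
Proof.
  intros hx. apply (ex_derive_continuous (fun t => Rpower t a)).
  eexists. now apply is_derive_Rpower.
Qed.

Lemma continuous_exp_opp (x : R) : continuous (fun t => exp (- t)) x.
Proof. apply (ex_derive_continuous (fun t => exp (- t))). auto_derive. exact I. Qed.

Lemma continuous_Gamma_integrand (a x : R) :
  0 < x -> continuous (fun t => Rpower t a * exp (- t)) x.
Proof.
  intros hx.
  apply (continuous_mult (fun t => Rpower t a) (fun t => exp (- t))).
  - now apply continuous_Rpower.
  - apply continuous_exp_opp.
Qed.

(** Write the product as [exp (t * (a * (ln t / t) - 1))]. Since [ln t / t] tends to 0, the exponent
    behaves like [- t], whatever the sign of [a]. *)
Lemma Gamma_integrand_lim_infty (a : R) :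
  filterlim (fun t => Rpower t a * exp (- t)) (Rbar_locally p_infty) (locally 0).
Proof.
  apply (is_lim_ext_loc (fun t => exp (t * (a * (ln t / t) - 1))) _ p_infty 0).
  - exists 0. intros t ht. unfold Rpower. rewrite <- exp_plus. f_equal. field. lra.
  - apply (is_lim_comp exp _ p_infty 0 m_infty).
    + apply is_lim_exp_m.
    + replace m_infty with (Rbar_mult p_infty (a * 0 - 1)).
      * apply (is_lim_mult _ _ p_infty p_infty (a * 0 - 1)).
        -- apply is_lim_id.
        -- apply (is_lim_minus _ _ p_infty (a * 0) 1).
           ++ apply (is_lim_scal_l _ a p_infty 0). apply is_lim_div_ln_p.
           ++ apply is_lim_const.
           ++ reflexivity.
        -- simpl. lra.
      * replace (a * 0 - 1) with (-1) by ring. simpl.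
        case Rle_dec; intros; [exfalso; lra | reflexivity].
    + exists 0. intros y _. discriminate.
Qed.

Lemma Rpower_lim_0 (a : R) :
  0 < a -> filterlim (fun t => Rpower t a) (at_right 0) (locally 0).
Proof.
  intros ha.
  apply (filterlim_comp _ _ _ ln (fun y => exp (a * y)) _ (Rbar_locally m_infty)).
  - apply is_lim_ln_0.
  - apply (is_lim_comp exp _ m_infty 0 m_infty).
    + apply is_lim_exp_m.
    + replace m_infty with (Rbar_mult a m_infty) at 2.
      * apply is_lim_scal_l. apply is_lim_id.
      * simpl. case Rle_dec; intros h; [|exfalso; lra].
        case Rle_lt_or_eq_dec; intros; [reflexivity | exfalso; lra].
    + exists 0. intros y _. discriminate.
Qed.

(** This and the limit at infinity are the two boundary terms of the integration by parts that gives
    [Gamma_succ]. *)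
Lemma Gamma_integrand_lim_0 (a : R) : 0 < a ->
  filterlim (fun t => Rpower t a * exp (- t)) (at_right 0) (locally 0).
Proof.
  intros ha. replace (locally 0) with (locally (0 * exp (- 0))) by (f_equal; ring).
  apply (filterlim_comp_2 (fun t => Rpower t a) (fun t => exp (- t)) Rmult
           (G := locally 0) (H := locally (exp (- 0)))).
  - now apply Rpower_lim_0.
  - intros P hP. apply (filter_le_within (F := locally 0)). exact (continuous_exp_opp 0 P hP).
  - apply (filterlim_mult 0 (exp (- 0))).
Qed.

(** * Convergence of Euler's integral and the functional equation of Gamma *)

Lemma ex_RInt_pos (f : R -> R) (u v : R) :
  (forall x, 0 < x -> continuous f x) -> 0 < u -> 0 < v -> ex_RInt f u v.
Proof.
  intros hf hu hv. apply (ex_RInt_continuous f). intros x hx. apply hf.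
  apply Rlt_le_trans with (Rmin u v); [now apply Rmin_pos | apply hx].
Qed.

(** The absolute values on both sides make the bound independent of the order of [u] and [v], which
    a Cauchy criterion over a filter does not prescribe. *)
Lemma abs_RInt_le_dominated (f h H : R -> R) (u v : R) :
  (forall x, Rmin u v <= x <= Rmax u v ->
     continuous f x /\ continuous h x /\ is_derive H x (h x) /\ 0 <= f x <= h x) ->
  Rabs (RInt f u v) <= Rabs (H v - H u).
Proof.
  assert (main : forall a b, a <= b ->
    (forall x, a <= x <= b ->
      continuous f x /\ continuous h x /\ is_derive H x (h x) /\ 0 <= f x <= h x) ->
    Rabs (RInt f a b) <= Rabs (H b - H a)).
  { intros a b hab hyp.
    assert (If : ex_RInt f a b).
    { apply (ex_RInt_continuous f). rewrite Rmin_left, Rmax_right by lra. apply hyp. }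
    assert (Ih : is_RInt h a b (H b - H a)).
    { apply (is_RInt_derive H h); rewrite Rmin_left, Rmax_right by lra; apply hyp. }
    assert (h0 : 0 <= RInt f a b).
    { apply RInt_ge_0; try easy. intros x hx. apply hyp. lra. }
    rewrite (Rabs_pos_eq _ h0).
    apply Rle_trans with (2 := RRle_abs _).
    rewrite <- (is_RInt_unique _ _ _ _ Ih).
    apply RInt_le; try easy.
    - eexists; exact Ih.
    - intros x hx. apply hyp. lra. }
  intros hyp. destruct (Rle_lt_dec u v) as [huv | hvu].
  - apply main; trivial. now rewrite Rmin_left, Rmax_right in hyp by lra.
  - rewrite <- (opp_RInt_swap f).
    + change (Rabs (- RInt f v u) <= Rabs (H v - H u)).
      rewrite Rabs_Ropp, (Rabs_minus_sym (H v)). apply main; [lra|].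
      now rewrite Rmin_right, Rmax_left in hyp by lra.
    + apply (ex_RInt_continuous f). rewrite Rmin_comm, Rmax_comm. apply hyp.
Qed.

(* Cauchy criterion: near [F] the increments of [RInt f 1] are controlled by
   those of the convergent antiderivative [H] of the dominating function. *)
Lemma ex_RInt_gen_dominated (F : (R -> Prop) -> Prop) (f h H : R -> R)
    (P : R -> Prop) (l : R) :
  ProperFilter F -> F P -> F (fun u => 0 < u) ->
  (forall u v x, P u -> P v -> Rmin u v <= x <= Rmax u v -> 0 <= f x <= h x) ->
  (forall x, 0 < x -> continuous f x) ->
  (forall x, 0 < x -> continuous h x) ->
  (forall x, 0 < x -> is_derive H x (h x)) ->
  filterlim H F (locally l) ->
  ex_RInt_gen f (at_point 1) F.
Proof.
  intros pF FP Fpos hP cf ch dH limH.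
  assert (lim : exists y, filterlim (RInt f 1) F (locally y)).
  { apply filterlim_locally_cauchy. intros eps.
    destruct (proj2 (filterlim_locally_cauchy (F := F) H) (ex_intro _ l limH) eps)
      as [Q [FQ hQ]].
    exists (fun u => Q u /\ P u /\ 0 < u). split.
    - now repeat apply filter_and.
    - intros u v [Qu [Pu pu]] [Qv [Pv pv]].
      specialize (hQ u v Qu Qv).
      change (Rabs (H v - H u) < eps) in hQ.
      change (Rabs (RInt f 1 v - RInt f 1 u) < eps).
      replace (RInt f 1 v - RInt f 1 u) with (RInt f u v).
      + apply Rle_lt_trans with (2 := hQ). apply (abs_RInt_le_dominated f h).
        intros x hx. assert (0 < x).
        { apply Rlt_le_trans with (Rmin u v); [now apply Rmin_pos | apply hx]. }
        split; [now apply cf|]. split; [now apply ch|]. split; [now apply dH|].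
        now apply (hP u v).
      + assert (E := RInt_Chasles f 1 u v).
        assert (E' : RInt f 1 u + RInt f u v = RInt f 1 v).
        { apply E; apply ex_RInt_pos; auto; lra. }
        lra. }
  destruct lim as [y hy]. exists y. intros Q HQ.
  exists (fun u => u = 1) (fun v => 0 < v /\ Q (RInt f 1 v)).
  - reflexivity.
  - apply filter_and; trivial. now apply hy.
  - intros u v -> [pv Qv]. exists (RInt f 1 v). split; trivial.
    apply (RInt_correct f). apply ex_RInt_pos; trivial; lra.
Qed.

Lemma exp_opp_le_1 (x : R) : 0 < x -> exp (- x) <= 1.
Proof. intros hx. rewrite <- exp_0. left. apply exp_increasing. lra. Qed.

Lemma at_right_0_pos : at_right 0 (fun u => 0 < u).
Proof. now exists (mkposreal 1 Rlt_0_1). Qed.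

Lemma p_infty_pos : Rbar_locally p_infty (fun u => 0 < u).
Proof. now exists 0. Qed.

(** Puts pointwise facts on the positive half-line into the form in which the lemmas on improper
    integrals ask for them. *)
Lemma filter_prod_segment_pos (P : R -> Prop) :
  (forall x, 0 < x -> P x) ->
  filter_prod (at_right 0) (Rbar_locally p_infty) (fun ab =>
    forall x, Rmin (fst ab) (snd ab) <= x <= Rmax (fst ab) (snd ab) -> P x).
Proof.
  intros hP.
  exists (fun u => 0 < u) (fun u => 0 < u).
  - apply at_right_0_pos.
  - apply p_infty_pos.
  - simpl. intros u v hu hv x hx. apply hP.
    apply Rlt_le_trans with (Rmin u v); [now apply Rmin_pos | apply hx].
Qed.

(** The integral is split at 1. Near 0 the integrand is dominated by [t^(a-1)], with antiderivative
    [t^a / a], which tends to 0 because [a > 0]; near infinity by [1 / t^2], with antiderivative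
    [- 1 / t]. *)
Lemma ex_RInt_gen_Gamma (a : R) : 0 < a ->
  ex_RInt_gen (fun t => Rpower t (a - 1) * exp (- t))
    (at_right 0) (Rbar_locally p_infty).
Proof.
  intros ha. set (f := fun t => _).
  assert (cf : forall x, 0 < x -> continuous f x).
  { intros x hx. now apply continuous_Gamma_integrand. }
  assert (E0 : ex_RInt_gen f (at_point 1) (at_right 0)).
  { apply (ex_RInt_gen_dominated _ f (fun t => Rpower t (a - 1))
             (fun t => / a * Rpower t a) (fun u => 0 < u) (/ a * 0)); auto.
    - apply at_right_proper_filter.
    - apply at_right_0_pos.
    - apply at_right_0_pos.
    - intros u v x hu hv hx.
      assert (hx0 : 0 < x).
      { apply Rlt_le_trans with (Rmin u v); [now apply Rmin_pos | apply hx]. }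
      assert (hp := exp_pos ((a - 1) * ln x)). fold (Rpower x (a - 1)) in hp.
      assert (he := exp_pos (- x)). assert (he1 := exp_opp_le_1 x hx0).
      unfold f. split; [nra | nra].
    - intros x hx. now apply continuous_Rpower.
    - intros x hx.
      replace (Rpower x (a - 1)) with (/ a * (a * Rpower x (a - 1))) by (field; lra).
      apply (is_derive_scal (fun t => Rpower t a)). now apply is_derive_Rpower.
    - apply (filterlim_comp _ _ _ (fun t => Rpower t a) (fun y => / a * y) _ (locally 0)).
      + now apply Rpower_lim_0.
      + apply (filterlim_scal_r (/ a) 0). }
  assert (E1 : ex_RInt_gen f (at_point 1) (Rbar_locally p_infty)).
  (* Beyond some [M] the quantity [t^(a+1) * exp (- t)] is below 1; dividing by [t^2] gives the
     domination by [1 / t^2]. *)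
  { assert (lim := Gamma_integrand_lim_infty (a + 1)).
    destruct (lim _ (locally_ball 0 (mkposreal 1 Rlt_0_1))) as [M hM].
    apply (ex_RInt_gen_dominated _ f (fun t => / t ^ 2)
             (fun t => - / t) (fun u => Rmax 0 M < u) (- 0)); auto.
    - apply Rbar_locally_filter.
    - now exists (Rmax 0 M).
    - apply p_infty_pos.
    - intros u v x hu hv hx.
      assert (hx0 : Rmax 0 M < x).
      { apply Rlt_le_trans with (Rmin u v); [now apply Rmin_glb_lt | apply hx]. }
      assert (0 < x) by (apply Rle_lt_trans with (2 := hx0), Rmax_l).
      assert (hMx : M < x) by (apply Rle_lt_trans with (2 := hx0), Rmax_r).
      specialize (hM x hMx). apply Rabs_def2 in hM.
      assert (he := exp_pos (- x)).
      assert (hp := exp_pos ((a - 1) * ln x)). fold (Rpower x (a - 1)) in hp.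
      replace (a + 1) with (a - 1 + INR 2) in hM by (simpl; ring).
      rewrite Rpower_plus, Rpower_pow in hM by trivial.
      unfold minus, plus, opp in hM; simpl in hM. unfold f. split.
      + nra.
      + apply Rmult_le_reg_r with (x ^ 2); [nra|].
        rewrite Rinv_l by nra. nra.
    - intros x hx. apply (ex_derive_continuous (fun t => / t ^ 2)). auto_derive. nra.
    - intros x hx. auto_derive; [lra | field; lra].
    - apply (is_lim_opp Rinv p_infty 0). apply (is_lim_inv (fun t => t) p_infty p_infty).
      + apply is_lim_id.
      + discriminate. }
  destruct E0 as [l0 h0], E1 as [l1 h1]. eexists.
  apply (is_RInt_gen_Chasles f 1); [|exact h1].
  apply (is_RInt_gen_swap f). exact h0.
Qed.

Lemma is_RInt_gen_Gamma (a : R) : 0 < a ->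
  is_RInt_gen (fun t => Rpower t (a - 1) * exp (- t))
    (at_right 0) (Rbar_locally p_infty) (Gamma a).
Proof.
  intros ha. apply (RInt_gen_correct (V := R_CompleteNormedModule)). now apply ex_RInt_gen_Gamma.
Qed.

(** Integration by parts: [t^a * exp (- t)] vanishes at both ends, so its derivative [a * t^(a-1) *
    exp (- t) - t^a * exp (- t)] has integral 0. *)
Lemma Gamma_succ (a : R) : 0 < a -> Gamma (a + 1) = a * Gamma a.
Proof.
  intros ha.
  assert (dP : forall x, 0 < x -> is_derive (fun t => Rpower t a * exp (- t)) x
            (a * (Rpower x (a - 1) * exp (- x)) - Rpower x a * exp (- x))).
  { intros x hx.
    replace (_ - _) with (a * Rpower x (a - 1) * exp (- x) + Rpower x a * (- exp (- x)))
      by ring.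
    apply (is_derive_mult (fun t => Rpower t a) (fun t => exp (- t))).
    - now apply is_derive_Rpower.
    - auto_derive; [exact I | ring].
    - intros. apply Rmult_comm. }
  assert (I0 : is_RInt_gen (Derive (fun t => Rpower t a * exp (- t)))
                 (at_right 0) (Rbar_locally p_infty) (0 - 0)).
  { apply is_RInt_gen_Derive.
    - apply filter_prod_segment_pos. intros x hx. eexists. now apply dP.
    - apply filter_prod_segment_pos. intros x hx.
      (* The formula for the derivative is known only at positive points, so it replaces [Derive] on
         the ball of radius [x] around [x]. *)
      apply continuous_ext_loc with
        (fun x => a * (Rpower x (a - 1) * exp (- x)) - Rpower x a * exp (- x)).
      + exists (mkposreal x hx). intros y hy. symmetry. apply is_derive_unique, dP.
        apply Rabs_def2 in hy. unfold minus, plus, opp in hy; simpl in hy. lra.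
      + apply (continuous_minus (fun x => a * (Rpower x (a - 1) * exp (- x)))
                 (fun x => Rpower x a * exp (- x))).
        * apply (continuous_scal_r a (fun x => Rpower x (a - 1) * exp (- x))).
          now apply continuous_Gamma_integrand.
        * now apply continuous_Gamma_integrand.
    - now apply Gamma_integrand_lim_0.
    - apply Gamma_integrand_lim_infty. }
  unfold Gamma at 1.
  apply (is_RInt_gen_unique (fun t => Rpower t (a + 1 - 1) * exp (- t))).
  (* The zero boundary term is written out so that the integrand can be split as a multiple of the
     one for [Gamma a] minus the derivative. *)
  replace (a * Gamma a) with (a * Gamma a - (0 - 0)) by ring.
  apply is_RInt_gen_ext with
    (fun t => a * (Rpower t (a - 1) * exp (- t)) - Derive (fun t => Rpower t a * exp (- t)) t).
  - apply filter_imp with (2 := filter_prod_segment_pos (fun x => 0 < x) (fun x h => h)).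
    intros ab hab x hx.
    assert (hx0 : 0 < x) by (apply hab; split; left; apply hx).
    assert (Dx : Derive (fun t => Rpower t a * exp (- t)) x
                 = a * (Rpower x (a - 1) * exp (- x)) - Rpower x a * exp (- x))
      by now apply is_derive_unique, dP.
    change (a * (Rpower x (a - 1) * exp (- x)) - Derive (fun t => Rpower t a * exp (- t)) x
            = Rpower x (a + 1 - 1) * exp (- x)).
    rewrite Dx.
    replace (a + 1 - 1) with a by ring. ring.
  - apply (is_RInt_gen_minus (fun t => a * (Rpower t (a - 1) * exp (- t)))); trivial.
    apply (is_RInt_gen_scal (fun t => Rpower t (a - 1) * exp (- t)) a).
    now apply is_RInt_gen_Gamma.
Qed.

(** * The entire series behind the Bessel function *)

Lemma pochhammer_succ (a : R) (i : nat) :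
  0 < a -> pochhammer a (S i) = (a + INR i) * pochhammer a i.
Proof.
  intros ha. unfold pochhammer. rewrite S_INR, <- Rplus_assoc, Gamma_succ.
  - unfold Rdiv. ring.
  - assert (h := pos_INR i). lra.
Qed.

(** Coefficients of the series of [BesselJ (2 * k - 1)] in the square of its argument, without the
    prefactor: the hypergeometric series 0F1(; 2k; -x/4). In this variable the square root
    disappears. *)
Definition bessel_coeff (k : R) (i : nat) : R :=
  / pochhammer (2 * k) i * ((- / 4) ^ i / INR (fact i)).

(* [Rinv_mult] also holds for the junk value [/ 0 = 0], so the positivity of
   Gamma is not needed. *)
Lemma bessel_coeff_succ (k : R) (i : nat) : 0 < k ->
  (2 * k + INR i) * (INR (S i) * bessel_coeff k (S i)) = - / 4 * bessel_coeff k i.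
Proof.
  intros hk. unfold bessel_coeff.
  rewrite pochhammer_succ, fact_simpl, mult_INR by lra.
  unfold Rdiv. rewrite !Rinv_mult. simpl pow.
  assert (h := pos_INR i). assert (0 < INR (S i)) by (apply lt_0_INR, Nat.lt_0_succ).
  set (p := / pochhammer (2 * k) i). set (q := / INR (fact i)).
  field. split; lra.
Qed.

(** Iterating the hypothesis gives [|a n| <= |a 0| * B^n / n!], so for each [r >= 0] the terms
    [|a n| * r^n] are bounded by [|a 0| * exp (B * r)]. *)
Lemma CV_radius_infinite (a : nat -> R) (B : R) : 0 <= B ->
  (forall n, INR (S n) * Rabs (a (S n)) <= B * Rabs (a n)) -> CV_radius a = p_infty.
Proof.
  intros hB ha.
  assert (bound : forall n, Rabs (a n) <= Rabs (a O) * (B ^ n / INR (fact n))).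
  { induction n as [|n IH].
    - simpl. lra.
    - specialize (ha n).
      assert (hS : 0 < INR (S n)) by (apply lt_0_INR, Nat.lt_0_succ).
      assert (hf := INR_fact_lt_0 n).
      apply Rmult_le_reg_l with (INR (S n)); trivial.
      apply Rle_trans with (1 := ha).
      apply Rle_trans with (B * (Rabs (a O) * (B ^ n / INR (fact n)))).
      + now apply Rmult_le_compat_l.
      + apply Req_le. rewrite fact_simpl, mult_INR. simpl pow. field. lra. }
  destruct (CV_radius_bounded a) as [ub _].
  assert (all : forall r, 0 <= r -> Rbar_le r (CV_radius a)).
  { intros r hr. apply ub. exists (Rabs (a O) * exp (B * r)). intros n.
    rewrite Rabs_mult, (Rabs_pos_eq (r ^ n)) by now apply pow_le.
    apply Rle_trans with (Rabs (a O) * ((B * r) ^ n / INR (fact n))).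
    - rewrite Rpow_mult_distr.
      replace (_ * (_ / _)) with (Rabs (a O) * (B ^ n / INR (fact n)) * r ^ n)
        by (unfold Rdiv; ring).
      apply Rmult_le_compat_r; [now apply pow_le | apply bound].
    - apply Rmult_le_compat_l; [apply Rabs_pos|].
      assert (hx : 0 <= B * r) by now apply Rmult_le_pos.
      (* A single Taylor term is at most the partial sum that ends with it, since the other terms
         are nonnegative. *)
      apply Rle_trans with (2 := exp_ge_taylor _ n hx).
      assert (term : forall m, 0 <= (B * r) ^ m / INR (fact m)).
      { intros m. apply Rdiv_le_0_compat; [now apply pow_le | apply INR_fact_lt_0]. }
      destruct n as [|n]; [apply Rle_refl|].
      rewrite tech5.
      assert (0 <= sum_f_R0 (fun m => (B * r) ^ m / INR (fact m)) n)
        by now apply cond_pos_sum.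
      lra. }
  (* A finite radius [r] would be at least [|r| + 1], and a radius of minus infinity at least 0. *)
  destruct (CV_radius a) as [r| |]; trivial.
  - assert (h := all (Rabs r + 1)). assert (h' := Rle_abs r). assert (h'' := Rabs_pos r).
    simpl in h. lra.
  - now specialize (all 0 (Rle_refl 0)).
Qed.

Lemma CV_radius_bessel_coeff (k : R) : 0 < k -> CV_radius (bessel_coeff k) = p_infty.
Proof.
  (* The recurrence has the factor [2 * k + n >= 2 * k] on the left and [1/4] on the right, whence
     the ratio [1 / (8 * k)]. *)
  intros hk. apply CV_radius_infinite with (/ (8 * k)).
  - left. apply Rinv_0_lt_compat. lra.
  - intros n. assert (E := f_equal Rabs (bessel_coeff_succ k n hk)).
    assert (h := pos_INR n).
    rewrite !Rabs_mult, Rabs_Ropp, (Rabs_pos_eq (2 * k + INR n)),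
      (Rabs_pos_eq (INR (S n))), (Rabs_pos_eq (/ 4)) in E by (try apply pos_INR; lra).
    assert (hx : 0 <= INR (S n) * Rabs (bessel_coeff k (S n)))
      by (apply Rmult_le_pos; [apply pos_INR | apply Rabs_pos]).
    apply Rmult_le_reg_l with (8 * k); [lra|].
    replace (8 * k * (/ (8 * k) * _)) with (Rabs (bessel_coeff k n)) by (field; lra).
    nra.
Qed.

Definition bessel_entire (k x : R) : R := PSeries (bessel_coeff k) x.
Definition bessel_entire' (k x : R) : R := PSeries (PS_derive (bessel_coeff k)) x.
Definition bessel_entire'' (k x : R) : R :=
  PSeries (PS_derive (PS_derive (bessel_coeff k))) x.

Lemma is_derive_entire (a : nat -> R) (x : R) :
  CV_radius a = p_infty -> is_derive (PSeries a) x (PSeries (PS_derive a) x).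
Proof. intros ha. apply is_derive_PSeries. now rewrite ha. Qed.

Lemma is_derive_entire_scal (a : nat -> R) (w x : R) : CV_radius a = p_infty ->
  is_derive (fun t => PSeries a (t * w)) x (w * PSeries (PS_derive a) (x * w)).
Proof.
  intros ha. apply (is_derive_comp (PSeries a) (fun t => t * w)).
  - now apply is_derive_entire.
  - auto_derive; [exact I | ring].
Qed.

(** Compare coefficients: that of [x^n] in [x phi'' + 2k phi'] is [(2k + n) (n + 1) c (n + 1)],
    which the recurrence turns into [- c n / 4]. *)
Lemma bessel_entire_ode (k x : R) : 0 < k ->
  x * bessel_entire'' k x = - 2 * k * bessel_entire' k x - / 4 * bessel_entire k x.
Proof.
  intros hk. unfold bessel_entire, bessel_entire', bessel_entire''.
  set (c := bessel_coeff k).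
  assert (hc : CV_radius c = p_infty) by now apply CV_radius_bessel_coeff.
  assert (E : PSeries (PS_plus (PS_incr_1 (PS_derive (PS_derive c)))
                               (PS_scal (2 * k) (PS_derive c))) x
            = PSeries (PS_scal (- / 4) c) x).
  { apply PSeries_ext. intros n.
    unfold PS_plus, PS_scal, PS_derive.
    change (PS_incr_1 (fun n => INR (S n) * (INR (S (S n)) * c (S (S n)))) n
              + 2 * k * (INR (S n) * c (S n)) = - / 4 * c n).
    assert (hn := bessel_coeff_succ k n hk). fold c in hn. rewrite <- hn.
    destruct n.
    - change (0 + 2 * k * (INR 1 * c 1%nat) = (2 * k + INR 0) * (INR 1 * c 1%nat)).
      simpl. ring.
    - change (INR (S n) * (INR (S (S n)) * c (S (S n)))
                + 2 * k * (INR (S (S n)) * c (S (S n)))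
              = (2 * k + INR (S n)) * (INR (S (S n)) * c (S (S n)))).
      ring. }
  rewrite PSeries_plus, PSeries_incr_1, !PSeries_scal in E.
  - lra.
  - apply CV_radius_inside. now rewrite CV_radius_incr_1, !CV_radius_derive, hc.
  - apply CV_radius_inside. rewrite CV_radius_scal by lra.
    now rewrite CV_radius_derive, hc.
Qed.

(** * The duality function expressed through the entire series *)

Definition bessel_const (k : R) : R := Rpower (/ 2) (2 * k - 1) / Gamma (2 * k).

(** The Bessel prefactor [(sqrt (z w) / 2)^(2k-1)] equals [(z w)^(k-1/2) * (1/2)^(2k-1)], and its
    first factor cancels [(z w)^(-k+1/2)]. *)
Lemma bessel_duality1_entire (k z w : R) : 0 < z -> 0 < w ->
  bessel_duality1 k z w =
  bessel_const k * exp (z / 2) * exp (w / 2) * bessel_entire k (z * w).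
Proof.
  intros hz hw. assert (hx : 0 < z * w) by now apply Rmult_lt_0_compat.
  unfold bessel_duality1, BesselJ, bessel_const.
  replace (2 * k - 1 + 1) with (2 * k) by ring.
  replace (Series _) with (bessel_entire k (z * w)).
  - replace (/ 2 * (z + w)) with (z / 2 + w / 2) by field. rewrite exp_plus.
    replace (Rpower (sqrt (z * w) / 2) (2 * k - 1))
      with (Rpower (z * w) (k - / 2) * Rpower (/ 2) (2 * k - 1)).
    + assert (E : Rpower (z * w) (- k + / 2) * Rpower (z * w) (k - / 2) = 1).
      { rewrite <- Rpower_plus. replace (_ + _) with 0 by ring. now apply Rpower_O. }
      unfold Rdiv.
      transitivity (exp (z * / 2) * exp (w * / 2)
        * (Rpower (z * w) (- k + / 2) * Rpower (z * w) (k - / 2))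
        * Rpower (/ 2) (2 * k - 1) * / Gamma (2 * k) * bessel_entire k (z * w)); [ring|].
      rewrite E. ring.
    + unfold Rdiv. rewrite <- (Rpower_mult_distr (sqrt (z * w))) by (try apply sqrt_lt_R0; lra).
      rewrite <- Rpower_sqrt by trivial. rewrite Rpower_mult.
      f_equal. f_equal. field.
  - apply Series_ext. intros i. unfold bessel_coeff.
    replace (- sqrt (z * w) ^ 2 / 4) with (- / 4 * (z * w)).
    + rewrite (Rpow_mult_distr (- / 4)). unfold Rdiv. ring.
    + rewrite pow2_sqrt by lra. field.
Qed.

(** * Smoothness of products of exponentials and entire series *)

Lemma ex_diff_n_product (C : (R -> R) -> Prop) :
  (forall g, C g -> exists g', C g' /\ forall x, is_derive g x (g' x)) ->
  forall n g h x y, C g -> C h -> ex_diff_n (fun u v => g u * h v) n x y.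
Proof.
  intros hC.
  assert (cont : forall g x, C g -> continuity_pt g x).
  { intros g x hg. destruct (hC g hg) as [g' [_ dg]].
    apply continuity_pt_filterlim. apply (ex_derive_continuous g). eexists. apply dg. }
  assert (cont2 : forall g h x y, C g -> C h ->
            continuity_2d_pt (fun u v => g u * h v) x y).
  { intros g h x y hg hh. apply continuity_2d_pt_mult.
    - apply (continuity_1d_2d_pt_comp g (fun u _ => u)); [now apply cont|].
      apply continuity_2d_pt_id1.
    - apply (continuity_1d_2d_pt_comp h (fun _ v => v)); [now apply cont|].
      apply continuity_2d_pt_id2. }
  (* Both partial derivatives of [g u * h v] are again products of two members of [C], so the
     induction runs with [g] and [h] left general. *)
  induction n as [|n IH]; intros g h x y hg hh; simpl.
  - split; [now apply cont2 | exact I].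
  - destruct (hC g hg) as [g' [hg' dg]], (hC h hh) as [h' [hh' dh]].
    assert (d1 : forall u v, is_derive (fun z => g z * h v) u (g' u * h v)).
    { intros u v. apply (is_derive_scal_l g u (g' u) (h v)), dg. }
    assert (d2 : forall u v, is_derive (fun z => g u * h z) v (g u * h' v)).
    { intros u v. apply (is_derive_scal h v (g u) (h' v)), dh. }
    split; [now apply cont2|]. split; [eexists; apply d1|]. split; [eexists; apply d2|].
    split.
    + apply ex_diff_n_ext_loc with (fun u v => g' u * h v).
      * apply locally_2d_forall. intros u v. symmetry. apply is_derive_unique, d1.
      * now apply IH.
    + apply ex_diff_n_ext_loc with (fun u v => g u * h' v).
      * apply locally_2d_forall. intros u v. symmetry. apply is_derive_unique, d2.
      * now apply IH.
Qed.

(** A class closed under differentiation: [c] and [w] stay fixed while the series [a] becomes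
    [a / 2 + w a']. Scaling a series by a nonzero [w] keeps its radius of convergence. *)
Definition exp_entire (g : R -> R) : Prop :=
  exists c w a, w <> 0 /\ CV_radius a = p_infty /\
    forall x, g x = c * exp (x / 2) * PSeries a (x * w).

Lemma exp_entire_derive (g : R -> R) :
  exp_entire g -> exists g', exp_entire g' /\ forall x, is_derive g x (g' x).
Proof.
  intros [c [w [a [hw [ha hg]]]]].
  set (b := PS_plus (PS_scal (/ 2) a) (PS_scal w (PS_derive a))).
  exists (fun x => c * exp (x / 2) * PSeries b (x * w)). split.
  - exists c, w, b. split; trivial. split; trivial.
    (* The radius of a sum is only bounded below by the smaller of the two radii; as both are
       infinite, this bound determines it. *)
    assert (h := CV_radius_plus (PS_scal (/ 2) a) (PS_scal w (PS_derive a))).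
    rewrite !CV_radius_scal, CV_radius_derive, ha in h by (trivial; lra).
    fold b in h. now destruct (CV_radius b).
  - intros x.
    apply is_derive_ext with (fun t => c * exp (t / 2) * PSeries a (t * w));
      [intros t; now rewrite hg|].
    replace (c * exp (x / 2) * PSeries b (x * w)) with
      (c * (exp (x / 2) / 2) * PSeries a (x * w)
       + c * exp (x / 2) * (w * PSeries (PS_derive a) (x * w))).
    + apply (is_derive_mult (fun t => c * exp (t / 2)) (fun t => PSeries a (t * w))).
      * auto_derive; [exact I | unfold Rdiv; ring].
      * now apply is_derive_entire_scal.
      * intros. apply Rmult_comm.
    + unfold b. rewrite PSeries_plus, !PSeries_scal; [field | |];
        apply CV_radius_inside; rewrite CV_radius_scal by (trivial; lra);
        now rewrite ?CV_radius_derive, ha.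
Qed.

(** * The generator applied to the duality function *)

Lemma locally_pos (x : R) : 0 < x -> locally x (fun t => 0 < t).
Proof. intros hx. now apply (open_gt 0). Qed.

(* The factor [exp ((z1 + z2) / 2)] is annihilated by the operator. *)
Lemma partial_diff_exp_mult (f : R * R -> R) (G Gx Gy : R -> R -> R) (z : R * R) :
  (forall z, quadrant z ->
     f z = exp (fst z / 2) * exp (snd z / 2) * G (fst z) (snd z)) ->
  (forall x y, is_derive (fun t => G t y) x (Gx x y)) ->
  (forall x y, is_derive (fun t => G x t) y (Gy x y)) ->
  quadrant z ->
  partial_diff f z =
  exp (fst z / 2) * exp (snd z / 2) * (Gx (fst z) (snd z) - Gy (fst z) (snd z)).
Proof.
  intros hf dx dy. destruct z as [x y]. intros [hx hy]; simpl in hx, hy.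
  assert (de : forall t, is_derive (fun t => exp (t / 2)) t (exp (t / 2) / 2)).
  { intros t. auto_derive; [exact I | unfold Rdiv; ring]. }
  assert (Dx : Derive (fun t => f (t, y)) x
               = exp (x / 2) / 2 * (exp (y / 2) * G x y)
                 + exp (x / 2) * (exp (y / 2) * Gx x y)).
  { rewrite (Derive_ext_loc _ (fun t => exp (t / 2) * (exp (y / 2) * G t y))).
    - apply is_derive_unique, (is_derive_mult (fun t => exp (t / 2))
                                 (fun t => exp (y / 2) * G t y));
        [apply de | | intros; apply Rmult_comm].
      apply (is_derive_scal (fun t => G t y) x (exp (y / 2))), dx.
    - apply filter_imp with (2 := locally_pos x hx). intros t ht.
      rewrite hf by easy. simpl. ring. }
  assert (Dy : Derive (fun t => f (x, t)) y
               = exp (y / 2) / 2 * (exp (x / 2) * G x y)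
                 + exp (y / 2) * (exp (x / 2) * Gy x y)).
  { rewrite (Derive_ext_loc _ (fun t => exp (t / 2) * (exp (x / 2) * G x t))).
    - apply is_derive_unique, (is_derive_mult (fun t => exp (t / 2))
                                 (fun t => exp (x / 2) * G x t));
        [apply de | | intros; apply Rmult_comm].
      apply (is_derive_scal (fun t => G x t) y (exp (x / 2))), dy.
    - apply filter_imp with (2 := locally_pos y hy). intros t ht.
      rewrite hf by easy. simpl. ring. }
  (* The derivatives of the two exponentials contribute the same term in [G x y / 2], which drops
     out of the difference. *)
  unfold partial_diff; simpl. rewrite Dx, Dy.
  field.
Qed.

Lemma is_derive_lincomb (f g : R -> R) (a b x f' g' : R) :
  is_derive f x f' -> is_derive g x g' ->
  is_derive (fun t => a * f t - b * g t) x (a * f' - b * g').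
Proof.
  intros df dg.
  apply (is_derive_minus (fun t => a * f t) (fun t => b * g t)).
  - now apply (is_derive_scal f).
  - now apply (is_derive_scal g).
Qed.

Lemma bessel_duality1_sym (k z w : R) : bessel_duality1 k z w = bessel_duality1 k w z.
Proof. unfold bessel_duality1. now rewrite (Rmult_comm z w), (Rplus_comm z w). Qed.

Lemma bessel_duality_sym (k : R) (z w : R * R) : bessel_duality k z w = bessel_duality k w z.
Proof.
  unfold bessel_duality.
  now rewrite (bessel_duality1_sym k (fst z)), (bessel_duality1_sym k (snd z)).
Qed.

(** Isolates the exponentials in [z], in the shape that [partial_diff_exp_mult] takes as input. *)
Lemma bessel_duality_entire (k : R) (z w : R * R) : quadrant z -> quadrant w ->
  bessel_duality k z w =
  exp (fst z / 2) * exp (snd z / 2) *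
  (bessel_const k ^ 2 * exp (fst w / 2) * exp (snd w / 2) *
   (bessel_entire k (fst z * fst w) * bessel_entire k (snd z * snd w))).
Proof.
  intros [hz1 hz2] [hw1 hw2]. unfold bessel_duality.
  rewrite !bessel_duality1_entire by trivial. ring.
Qed.

(** Taking any [f] that agrees with the section on the quadrant lets the lemma serve both arguments
    of the duality function, by symmetry. *)
Lemma bessel_duality_smooth (k : R) (w : R * R) (f : R * R -> R) :
  0 < k -> quadrant w -> (forall z, quadrant z -> f z = bessel_duality k z w) ->
  smooth_on_quadrant f.
Proof.
  intros hk hw hf z hz n.
  assert (hexp : forall c v, 0 < v ->
            exp_entire (fun x => c * exp (x / 2) * bessel_entire k (x * v))).
  { intros c v hv. exists c, v, (bessel_coeff k).
    repeat split; [lra | now apply CV_radius_bessel_coeff]. }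
  apply ex_diff_n_ext_loc with (fun x y =>
    (bessel_const k * exp (fst w / 2)) * exp (x / 2) * bessel_entire k (x * fst w) *
    ((bessel_const k * exp (snd w / 2)) * exp (y / 2) * bessel_entire k (y * snd w))).
  - apply locally_2d_locally.
    destruct z as [x y], hz as [hx hy]; simpl in *.
    (* With this radius the neighbourhood stays inside the quadrant, where the series formula
       holds. *)
    exists (mkposreal (Rmin x y) (Rmin_pos _ _ hx hy)). intros [u v] [hu hv]; simpl in *.
    apply Rabs_def2 in hu. apply Rabs_def2 in hv.
    unfold minus, plus, opp in hu, hv; simpl in hu, hv.
    assert (h1 := Rmin_l x y). assert (h2 := Rmin_r x y).
    assert (quadrant (u, v)) by (split; simpl; lra).
    rewrite hf, bessel_duality_entire by trivial. simpl. ring.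
  - apply (ex_diff_n_product exp_entire exp_entire_derive).
    + apply (hexp (bessel_const k * exp (fst w / 2))), hw.
    + apply (hexp (bessel_const k * exp (snd w / 2))), hw.
Qed.

(** [partial_diff f] is again the two exponentials times a function [G1] of the entire series, so
    [partial_diff_exp_mult] applies twice. *)
Lemma BEP_generator_bessel_duality (k : R) (z w : R * R) (f : R * R -> R) :
  0 < k -> quadrant z -> quadrant w ->
  (forall z, quadrant z -> f z = bessel_duality k z w) ->
  let phi := bessel_entire k in
  let phi' := bessel_entire' k in
  let x := fst z * fst w in
  let y := snd z * snd w in
  BEP_generator k f z =
  bessel_const k ^ 2 *
  (exp (fst z / 2) * exp (snd z / 2) * exp (fst w / 2) * exp (snd w / 2)) *
  (- / 4 * (snd z * fst w + fst z * snd w) * phi x * phi y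
   - 2 * x * y * phi' x * phi' y
   - 2 * k * (x * phi' x * phi y + y * phi x * phi' y)).
Proof.
  intros hk hz hw hf phi phi' x y.
  set (phi'' := bessel_entire'' k).
  set (K := bessel_const k ^ 2 * exp (fst w / 2) * exp (snd w / 2)).
  assert (hc := CV_radius_bessel_coeff k hk).
  assert (d0 : forall v t, is_derive (fun t => phi (t * v)) t (v * phi' (t * v))).
  { intros v t. now apply is_derive_entire_scal. }
  assert (d1 : forall v t, is_derive (fun t => phi' (t * v)) t (v * phi'' (t * v))).
  { intros v t. apply is_derive_entire_scal. now rewrite CV_radius_derive. }
  set (G1 := fun s t => K * (fst w * phi' (s * fst w) * phi (t * snd w)
                             - snd w * phi (s * fst w) * phi' (t * snd w))).
  assert (E1 : forall z, quadrant z -> partial_diff f z =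
            exp (fst z / 2) * exp (snd z / 2) * G1 (fst z) (snd z)).
  { intros z' hz'.
    rewrite (partial_diff_exp_mult f
      (fun s t => K * (phi (s * fst w) * phi (t * snd w)))
      (fun s t => K * (fst w * phi' (s * fst w) * phi (t * snd w)))
      (fun s t => K * (phi (s * fst w) * (snd w * phi' (t * snd w))))); trivial.
    - unfold G1. ring.
    - intros u hu. rewrite hf by trivial. now apply bessel_duality_entire.
    - intros s t. apply (is_derive_scal (fun s => phi (s * fst w) * phi (t * snd w))).
      apply (is_derive_scal_l (fun s => phi (s * fst w)) s (fst w * phi' (s * fst w))
               (phi (t * snd w))). apply d0.
    - intros s t. apply (is_derive_scal (fun t => phi (s * fst w) * phi (t * snd w))).
      apply (is_derive_scal (fun t => phi (t * snd w))). apply d0. }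
  unfold BEP_generator. rewrite (E1 z hz).
  rewrite (partial_diff_exp_mult (partial_diff f) G1
    (fun s t => K * (fst w ^ 2 * phi'' (s * fst w) * phi (t * snd w)
                     - fst w * snd w * phi' (s * fst w) * phi' (t * snd w)))
    (fun s t => K * (fst w * snd w * phi' (s * fst w) * phi' (t * snd w)
                     - snd w ^ 2 * phi (s * fst w) * phi'' (t * snd w)))); trivial.
  - assert (ox := bessel_entire_ode k x hk). assert (oy := bessel_entire_ode k y hk).
    fold phi phi' phi'' in ox, oy. unfold G1. fold x y.
    (* The coefficient [z1 z2 w1^2] of [phi'' x] is split as [z2 w1 * x], and likewise for [y], to
       expose the left side of the differential equation. *)
    transitivity (exp (fst z / 2) * exp (snd z / 2) * K *
      (snd z * fst w * (x * phi'' x) * phi y + fst z * snd w * phi x * (y * phi'' y)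
       - 2 * x * y * phi' x * phi' y
       - 2 * k * (fst z - snd z) * (fst w * phi' x * phi y - snd w * phi x * phi' y))).
    + unfold x, y. ring.
    (* The equation contributes [- 2k z2 w1 phi' x * phi y], which joins the drift term
       [- 2k (z1 - z2) w1 phi' x * phi y] to leave [- 2k x phi' x * phi y]; the terms in [phi' y]
       combine in the same way. *)
    + rewrite ox, oy. unfold K, x, y. ring.
  - intros s t. unfold G1.
    apply is_derive_ext with (fun s =>
      K * fst w * phi (t * snd w) * phi' (s * fst w)
      - K * snd w * phi' (t * snd w) * phi (s * fst w)).
    { intros u. simpl. ring. }
    evar_last.
    + apply (is_derive_lincomb (fun s => phi' (s * fst w)) (fun s => phi (s * fst w)));
        [apply d1 | apply d0].
    + simpl. ring.
  - intros s t. unfold G1.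
    apply is_derive_ext with (fun t =>
      K * fst w * phi' (s * fst w) * phi (t * snd w)
      - K * snd w * phi (s * fst w) * phi' (t * snd w)).
    { intros u. simpl. ring. }
    evar_last.
    + apply (is_derive_lincomb (fun t => phi (t * snd w)) (fun t => phi' (t * snd w)));
        [apply d0 | apply d1].
    + simpl. ring.
Qed.

Theorem theorem4p8 (k : R) (hk : 0 < k) :
  self_dual quadrant smooth_on_quadrant (BEP_generator k) (bessel_duality k).
Proof.
  intros z w hz hw.
  assert (sym : forall w', quadrant w' -> bessel_duality k z w' = bessel_duality k w' z)
    by (intros; apply bessel_duality_sym).
  split; [|split].
  - now apply (bessel_duality_smooth k w).
  - now apply (bessel_duality_smooth k z).
  - rewrite (BEP_generator_bessel_duality k z w) by easy.
    rewrite (BEP_generator_bessel_duality k w z) by easy.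
    (* The arguments of the entire series must agree syntactically, since [ring] treats their values
       as atoms. *)
    rewrite (Rmult_comm (fst w) (fst z)), (Rmult_comm (snd w) (snd z)).
    ring.
Qed.
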